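(* Let $n, N \geq 1$ be integers, let $f : \mathbb{R}^n \to \mathbb{R}$ be a differentiable convex function and let $x_1, \dots, x_N \in \mathbb{R}^n$. Suppose that there exist vectors $\psi, \phi \in \mathbb{R}^n$ such that $\psi \leq x_i \leq \phi$ for all $i \in \{1,\dots,N\}$, and that $m, M \in \mathbb{R}^n$ are vectors such that $m \leq \nabla f(x_i) \leq M$ for all $i \in \{1,\dots,N\}$. Then for all real $p_i \geq 0$ ($i = 1,\dots,N$) with $P_N := \sum_{i=1}^{N} p_i > 0$, we have $$0 \leq \frac{1}{P_N} \sum_{i=1}^{N} p_i f(x_i) - f\left(\frac{1}{P_N} \sum_{i=1}^{N} p_i x_i\right) \leq \frac{1}{4} \|\phi - \psi\| \, \|M - m\|.$$
   Context: For vectors in $\mathbb{R}^n$, the order $u \leq v$ is the coordinatewise order: $u^k \leq v^k$ for every coordinate $k = 1,\dots,n$. $\|\cdot\|$ is the usual Euclidean norm on $\mathbb{R}^n$. $\nabla f(x) = \left(\frac{\partial f(x)}{\partial x^1}, \dots, \frac{\partial f(x)}{\partial x^n}\right)$ is the vector of partial derivatives of $f$ at $x$. *)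

(* Defs.v *)
From HB Require Import structures.
From mathcomp Require Import all_boot all_order all_algebra.
From mathcomp Require Import all_classical all_reals all_analysis.

Set Implicit Arguments.
Unset Strict Implicit.
Unset Printing Implicit Defensive.

Import Order.TTheory GRing.Theory Num.Theory.
Import numFieldNormedType.Exports.

Local Open Scope ring_scope.

Definition vec_le (R : realType) (n : nat) (u v : 'rV[R]_n) : Prop :=
  forall k : 'I_n, u 0 k <= v 0 k.

(* The library norm `|v| on 'rV[R]_n is the sup norm, hence this definition. *)
Definition enorm (R : realType) (n : nat) (v : 'rV[R]_n) : R :=
  Num.sqrt (\sum_(k < n) v 0 k ^+ 2).

(* The k-th partial derivative is the derivative along the k-th standard
   basis vector. *)
Definition gradient (R : realType) (n : nat) (f : 'rV[R]_n -> R)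
    (x : 'rV[R]_n) : 'rV[R]_n :=
  \row_(k < n) 'D_(delta_mx 0 k) f x.

(* Main.v *)
Require Import Defs.
From HB Require Import structures.
From mathcomp Require Import all_boot all_order all_algebra.
From mathcomp Require Import all_classical all_reals all_analysis.
From mathcomp Require Import ring lra.

Set Implicit Arguments.
Unset Strict Implicit.
Unset Printing Implicit Defensive.

Import Order.TTheory GRing.Theory Num.Theory.
Import numFieldNormedType.Exports.

Local Open Scope classical_set_scope.
Local Open Scope ring_scope.

(* Convexity gives f y - f x >= <grad f x, y - x>. At x = the weighted mean this
   is Jensen's inequality. At x = x_i and y = the mean, averaging bounds the
   Jensen gap by the sum over the coordinates k of the covariances of
   (grad f x_i)^k and x_i^k; Grüss' inequality bounds each of them by
   (M^k - m^k) (phi^k - psi^k) / 4, and Cauchy-Schwarz concludes. *)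

(** With [A], [B], [T] the three sums, [B * (A * B - T ^+ 2)] is the sum of the squares
    [(B * a i - T * b i) ^+ 2]. This gives [T ^+ 2 <= A * B] once [B > 0]; if [B = 0], every [b i]
    vanishes. *)
Lemma cauchy_schwarz_sum (R : rcfType) (I : finType) (a b : I -> R) :
  \sum_i a i * b i
    <= Num.sqrt (\sum_i a i ^+ 2) * Num.sqrt (\sum_i b i ^+ 2).
Proof.
set A := \sum_i a i ^+ 2; set B := \sum_i b i ^+ 2; set T := \sum_i a i * b i.
have A0 : 0 <= A by apply: sumr_ge0 => i _; exact: sqr_ge0.
have B0 : 0 <= B by apply: sumr_ge0 => i _; exact: sqr_ge0.
rewrite -sqrtrM // (le_trans (ler_norm T)) // -sqrtr_sqr ler_wsqrtr //.
have [B_eq0|B_neq0] := eqVneq B 0.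
  have b0 i : b i = 0.
    have /eqP := B_eq0; rewrite psumr_eq0 => [/allP/(_ i)|j _]; last first.
      exact: sqr_ge0.
    by rewrite mem_index_enum sqrf_eq0 => /(_ isT)/eqP.
  rewrite (_ : T = 0) ?B_eq0 ?mulr0 ?expr0n //.
  by rewrite /T big1 // => i _; rewrite b0 mulr0.
have B_gt0 : 0 < B by rewrite lt_neqAle eq_sym B_neq0.
rewrite -subr_ge0 -(pmulr_rge0 _ B_gt0).
suff -> : B * (A * B - T ^+ 2) = \sum_i (B * a i - T * b i) ^+ 2.
  by apply: sumr_ge0 => i _; exact: sqr_ge0.
transitivity (\sum_i (B ^+ 2 * a i ^+ 2 - (2 * B * T) * (a i * b i)
    + T ^+ 2 * b i ^+ 2)); last by apply: eq_bigr => i _; ring.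
rewrite big_split /= sumrB -!mulr_sumr -/A -/B -/T; ring.
Qed.

Section WeightedMeans.
Context {R : realFieldType} {I : finType}.
Variable w : I -> R.
Hypothesis w_ge0 : forall i, 0 <= w i.
Hypothesis w_sum1 : \sum_i w i = 1.
Implicit Types a b : I -> R.

Local Notation mean a := (\sum_i w i * a i).

Lemma wmean_le a b : (forall i, a i <= b i) -> mean a <= mean b.
Proof. by move=> ab; apply: ler_sum => i _; rewrite ler_wpM2l. Qed.

Lemma wmeanD a b : mean (fun i => a i + b i) = mean a + mean b.
Proof. by rewrite -big_split; apply: eq_bigr => i _; rewrite mulrDr. Qed.

Lemma wmeanZ c a : mean (fun i => c * a i) = c * mean a.
Proof. by rewrite mulr_sumr; apply: eq_bigr => i _; rewrite mulrCA. Qed.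

Lemma wmean_cst c : mean (fun=> c) = c.
Proof. by rewrite -mulr_suml w_sum1 mul1r. Qed.

(** The deviations of [b] from its mean average to zero. This allows [a] to be recentred at the
    midpoint of its range. *)
Lemma wmean_subr a b c :
  mean (fun i => (a i - c) * (b i - mean b))
    = mean (fun i => a i * (b i - mean b)).
Proof.
set B := mean b.
have -> : mean (fun i => (a i - c) * (b i - B)) =
          mean (fun i => a i * (b i - B) + ((- c) * b i + c * B)).
  by apply: eq_bigr => i _; congr (_ * _); ring.
by rewrite wmeanD wmeanD wmeanZ wmean_cst -/B mulNr addNr addr0.
Qed.

Lemma popoviciu b l u : (forall i, l <= b i <= u) ->
  mean (fun i => (b i - mean b) ^+ 2) <= (u - l) ^+ 2 / 4.
Proof.
move=> hb; set B := mean b.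
(* (b_i - l)(u - b_i) >= 0 *)
have : mean (fun i => (b i - B) ^+ 2)
       <= mean (fun i => (u + l - 2 * B) * b i + (B ^+ 2 - u * l)).
  by apply: wmean_le => i; have /andP[] := hb i; nra.
(* The right-hand mean equals [(u - B) * (B - l)], which falls short of [(u - l) ^+ 2 / 4] by
   exactly [(2 * B - u - l) ^+ 2 / 4]. *)
rewrite wmeanD wmeanZ wmean_cst -/B => /le_trans -> //.
have := sqr_ge0 (2 * B - u - l); nra.
Qed.

(** After recentring [a] at its midpoint, it remains to bound the mean of [|b i - mean b|]. An AM-GM
    step and [popoviciu] bound [u - l] times that mean by [(u - l) ^+ 2 / 2], without square
    roots. *)
Lemma gruss a b la ua l u :
    (forall i, la <= a i <= ua) -> (forall i, l <= b i <= u) ->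
  mean (fun i => a i * (b i - mean b)) <= 4^-1 * ((u - l) * (ua - la)).
Proof.
move=> ha hb; have var_le := popoviciu hb.
rewrite -(wmean_subr a b (2^-1 * (la + ua))).
set B := mean b in var_le *; set c := 2^-1 * _.
(* An index is needed to derive [la <= ua] and [l <= u]; one exists because the weights sum to 1. *)
have [i _|I0] := pickP I; last first.
  by have := w_sum1; rewrite big_pred0 // => /esym/eqP; rewrite oner_eq0.
have lau : la <= ua by have /andP[/le_trans] := ha i; apply.
have lu : l <= u by have /andP[/le_trans] := hb i; apply.
(* The main argument divides by [u - l]; when it is zero, [b] is constant and both sides vanish. *)
have [lu_eq|lu_neq] := eqVneq l u.
  have bE j : b j = l by apply/le_anti; rewrite andbC {2}lu_eq; exact: hb.
  rewrite lu_eq subrr mul0r mulr0 big1 // => j _.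
  rewrite /B bE (eq_bigr (fun j => w j * l)) => [|k _]; last by rewrite bE.
  by rewrite wmean_cst subrr !mulr0.
have lu_gt0 : 0 < u - l by rewrite subr_gt0 lt_neqAle lu_neq.
rewrite -(ler_pM2l lu_gt0) -wmeanZ.
set D := u - l in lu_gt0 var_le *.
(* |a_i - c| <= (ua - la) / 2 and D |z| <= z^2 + D^2 / 4 *)
have : mean (fun i => D * ((a i - c) * (b i - B)))
    <= mean (fun i => 2^-1 * (ua - la) * ((b i - B) ^+ 2 + D ^+ 2 / 4)).
  apply: wmean_le => j; have /andP[h1 h2] := ha j.
  set z := b j - B.
  have h3 : D * z <= z ^+ 2 + D ^+ 2 / 4 by have := sqr_ge0 (z - D / 2); nra.
  have h4 : - (D * z) <= z ^+ 2 + D ^+ 2 / 4 by have := sqr_ge0 (z + D / 2); nra.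
  rewrite /c; nra.
move/le_trans; apply.
by rewrite wmeanZ wmeanD wmean_cst; nra.
Qed.

End WeightedMeans.

Section ConvexGradient.
Context {R : realType} {n : nat}.
Implicit Types (f : 'rV[R]_n -> R) (x y v : 'rV[R]_n).

Lemma derive_gradient f x v : differentiable f x ->
  'D_v f x = \sum_k gradient f x 0 k * v 0 k.
Proof.
move=> dfx; rewrite deriveE // {1}(row_sum_delta v) linear_sum /=.
by apply: eq_bigr => k _; rewrite mxE deriveE // linearZ /= mulrC.
Qed.

(** Convexity on the segment from [x] to [y] bounds the difference quotient by [f y - f x] for every
    step [h] in []0, 1]], so a limit from the right suffices. *)
Lemma convex_derive_le f x y : derivable f x (y - x) ->
  convex_function [set: 'rV[R]_n] f -> 'D_(y - x) f x <= f y - f x.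
Proof.
move=> dfx f_convex; rewrite /derive cvg_at_rightE //.
apply: limr_le.
  by apply/cvg_ex; exists ('D_(y - x) f x); apply: cvg_dnbhs_at_right.
near=> h.
have h0 : 0 < h by near: h; exact: nbhs_right_gt.
have h1 : h <= 1 by near: h; exact: nbhs_right_ltW.
have h01 : Itv.spec (@Itv.num_sem R) (Itv.Real `[0%Z, 1%Z]) h.
  by rewrite /= /Itv.num_sem/= num_real/= in_itv/= (ltW h0) h1.
have := f_convex (Itv.mk h01) y x (in_setT _) (in_setT _).
rewrite convRE /= => fh.
rewrite /GRing.scale/= ler_pdivrMl // lerBlDr.
have -> : h *: (y - x) + x = h *: y + (1 - h) *: x.
  by rewrite scalerBr scalerBl scale1r addrA addrAC.
by rewrite (le_trans fh) // /unstable.onem; lra.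
Unshelve. all: by end_near. Qed.

Lemma convex_gradient_le f x y : differentiable f x ->
    convex_function [set: 'rV[R]_n] f ->
  \sum_k gradient f x 0 k * (y 0 k - x 0 k) <= f y - f x.
Proof.
move=> dfx f_convex.
have /convex_derive_le/(_ f_convex) : derivable f x (y - x).
  exact: diff_derivable.
rewrite derive_gradient //; congr (_ <= _); apply: eq_bigr => k _.
by rewrite !mxE.
Qed.

End ConvexGradient.

Theorem theorem1 (R : realType) (n N : nat) (hn : (0 < n)%N) (hN : (0 < N)%N)
    (f : 'rV[R]_n -> R)
    (f_diff : forall x : 'rV[R]_n, differentiable f x)
    (f_convex : convex_function [set: 'rV[R]_n] f)
    (x : 'I_N -> 'rV[R]_n)
    (psi phi : 'rV[R]_n)
    (hx : forall i : 'I_N, vec_le psi (x i) /\ vec_le (x i) phi)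
    (m M : 'rV[R]_n)
    (hgrad : forall i : 'I_N,
      vec_le m (gradient f (x i)) /\ vec_le (gradient f (x i)) M)
    (p : 'I_N -> R)
    (hp : forall i : 'I_N, 0 <= p i)
    (hP : 0 < \sum_(i < N) p i) :
  let P := \sum_(i < N) p i in
  0 <= P^-1 * (\sum_(i < N) p i * f (x i))
         - f (P^-1 *: (\sum_(i < N) p i *: x i))
    <= 4^-1 * enorm (phi - psi) * enorm (M - m).
Proof.
cbv zeta; set P := \sum_(i < N) p i in hP *; set xbar := P^-1 *: _.
pose w i := P^-1 * p i.
have w_ge0 i : 0 <= w i by rewrite mulr_ge0 // invr_ge0 ltW.
have w_sum1 : \sum_i w i = 1 by rewrite -mulr_sumr mulVf // gt_eqF.
have xbarE k : xbar 0 k = \sum_i w i * x i 0 k.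
  rewrite mxE summxE mulr_sumr; apply: eq_bigr => i _.
  by rewrite mxE mulrA.
have -> : P^-1 * (\sum_i p i * f (x i)) = \sum_i w i * f (x i).
  by rewrite mulr_sumr; apply: eq_bigr => i _; rewrite mulrA.
have gapE : \sum_i w i * f (x i) - f xbar
          = \sum_i w i * (f (x i) - f xbar).
  by rewrite (wmeanD _ _ (fun=> - f xbar)) wmean_cst.
apply/andP; split.
  rewrite gapE; apply: (@le_trans _ _ (\sum_i w i *
      (\sum_k gradient f xbar 0 k * (x i 0 k - xbar 0 k)))); last first.
    by apply: wmean_le => // i; exact: convex_gradient_le.
  under eq_bigr do rewrite mulr_sumr.
  rewrite exchange_big /= sumr_ge0 // => k _.
  (* The gradient at [xbar] does not depend on [i], so it factors out of a mean of deviations, which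
     is zero. *)
  rewrite (wmeanZ w (gradient f xbar 0 k) (fun i => x i 0 k - xbar 0 k)).
  by rewrite (wmeanD w (fun i => x i 0 k)) wmean_cst // xbarE subrr mulr0.
apply: (@le_trans _ _ (\sum_i w i *
    (\sum_k gradient f (x i) 0 k * (x i 0 k - xbar 0 k)))).
  rewrite gapE; apply: wmean_le => // i.
  rewrite -lerN2 opprB.
  apply: le_trans (convex_gradient_le xbar (f_diff (x i)) f_convex).
  by rewrite -sumrN; apply: ler_sum => k _; rewrite -mulrN opprB.
under eq_bigr do rewrite mulr_sumr.
rewrite exchange_big /= -mulrA.
apply: (@le_trans _ _ (4^-1 * \sum_k (phi - psi) 0 k * (M - m) 0 k)).
  (* [xbarE] exposes [xbar 0 k] as the weighted mean of the [x i 0 k], the form of covariance that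
     [gruss] expects. *)
  rewrite mulr_sumr; apply: ler_sum => k _; rewrite xbarE.
  rewrite [(phi - psi) _ _]mxE [(- psi) _ _]mxE.
  rewrite [(M - m) _ _]mxE [(- m) _ _]mxE.
  apply: gruss => // i; apply/andP.
    by have [] := hgrad i; split.
  by have [] := hx i; split.
by rewrite ler_wpM2l ?invr_ge0 // cauchy_schwarz_sum.
Qed.
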